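(* The space $\mathbb Z^\bullet=\mathbb Z\setminus\{0\}$ of nonzero integers endowed with the Kirch topology $\tau_K$ admits exactly two self-homeomorphisms.
   Context: The Kirch topology $\tau_K$ on $\mathbb Z^\bullet=\mathbb Z\setminus\{0\}$ is the topology generated by the subbase consisting of all cosets $a+p\mathbb Z=\{a+pn:n\in\mathbb Z\}$, where $a\in\mathbb Z^\bullet$ and $p$ is a prime number that does not divide $a$. A self-homeomorphism is a homeomorphism of $(\mathbb Z^\bullet,\tau_K)$ onto itself. *)

(* Defs.v *)
From HB Require Import structures.
From mathcomp Require Import all_boot all_order all_algebra.
From mathcomp Require Import all_classical.
From mathcomp Require Import topology.

Set Implicit Arguments.
Unset Strict Implicit.
Unset Printing Implicit Defensive.

Import GRing.Theory.

Local Open Scope classical_set_scope.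
Local Open Scope ring_scope.

(* The nonzero integers, under a name of their own so that the topology
   attached below is the only one on this type. *)
Definition kirchZ : Type := {x : int | x != 0}.

HB.instance Definition _ := SubChoice.on kirchZ.

(* a + pZ as a set of nonzero integers. When p does not divide a, 0 is not in
   a + pZ, so the restriction to nonzero elements removes nothing. *)
Definition kirch_coset (a : kirchZ) (p : nat) : set kirchZ :=
  [set x | exists n : int, val x = val a + p%:Z * n].

Definition kirch_subbase : set (set kirchZ) :=
  [set U | exists (a : kirchZ) (p : nat),
     [/\ prime p, ~~ (p%:Z %| val a)%Z & U = kirch_coset a p]].

(* The subbase is indexed by itself. *)
HB.instance Definition _ := isSubBaseTopological.Build kirchZ kirch_subbase id.

Definition homeomorphism (T U : topologicalType) (f : T -> U) : Prop :=
  continuous f /\ exists g : U -> T, [/\ cancel f g, cancel g f & continuous g].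

(* Main.v *)
Require Import Defs.
From mathcomp Require Import all_boot all_order all_algebra cyclic.
From mathcomp Require Import all_classical.
From mathcomp Require Import topology.
From mathcomp Require Import ring zify.

(** The only self-homeomorphisms are the identity and the negation. The proof
    extracts from the topology the congruences modulo all odd primes, and then
    shows that these congruences leave nothing else to move.

    From topology to arithmetic. The closure of a small neighbourhood of [x] is
    given by the conditions [z = 0] or [z = x] modulo [p], for the small primes
    [p] that do not divide [x] ([closure_kirch_nbhd]). For a finite set [E],
    consider the points [x] each of whose closed neighbourhoods contains an
    intersection of closed neighbourhoods of the points of [E]. This hull of
    [E] is carried along by homeomorphisms, and by the Chinese remainder theorem
    it is described one prime at a time ([kirch_hullE]). The maximal proper
    hulls turn out to be the sets [pZ] union [k + pZ] with [p] an odd prime not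
    dividing [k], so a homeomorphism permutes these sets ([homeo_coset0]).
    Finitely many of them cover the space only if they include, for some [q],
    all those of modulus [q] ([homeo_cover]); hence those of modulus [p] go to
    those of one modulus [q], and congruence modulo [p] becomes congruence
    modulo [q] ([homeo_congr]). Counting residue classes gives [q = p]
    ([homeo_dvdz]).

    Arithmetic. Extend the homeomorphism to a bijection [F] of the integers
    fixing [0]; then [F x - F y] and [x - y] have the same odd prime divisors.
    Join [x] and [y] when no odd prime divides [x], [y] or [x - y]. The vertices
    with a neighbour are the integers [2 ^ k] and [- 2 ^ k], and they form a
    ladder with rungs joining opposite integers ([adjacentP]). A ladder with an
    end has only one nontrivial symmetry, the exchange of its two sides, so
    there is a sign [e] with [F (2 ^ k) = e * 2 ^ k] for all [k] ([pow2_map]).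
    Any odd prime dividing [2 ^ k - x] then divides [F (2 ^ k) - F x], hence
    also [F x - e * x]. Since the numbers [2 ^ k - x] have infinitely many prime
    divisors ([exists_odd_prime_dvd]), [F x - e * x] is zero. *)

Set Implicit Arguments.
Unset Strict Implicit.
Unset Printing Implicit Defensive.

Import Order.TTheory GRing.Theory Num.Theory.

Local Open Scope classical_set_scope.
Local Open Scope card_scope.
Local Open Scope ring_scope.

(** * Integers modulo primes *)

Lemma dvdz_lincomb (u v d a b c : int) :
  (d %| a)%Z -> (d %| b)%Z -> c = u * a + v * b -> (d %| c)%Z.
Proof. by move=> da db ->; rewrite rpredD // dvdz_mull. Qed.

Arguments dvdz_lincomb u v {d a b c}.

Lemma Euclid_dvdzM (p : nat) (a b : int) : prime p ->
  (p %| a * b)%Z = (p %| a)%Z || (p %| b)%Z.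
Proof. by move=> p_pr; rewrite !dvdzE abszM Euclid_dvdM. Qed.

Lemma dvdz_prime2 (p q : nat) : prime p -> prime q ->
  (p %| q%:Z)%Z = (p == q).
Proof. by move=> pp pq; rewrite dvdzE dvdn_prime2. Qed.

Lemma ndvdz_neq0 (p : nat) (z : int) : ~~ (p %| z)%Z -> z != 0.
Proof. by apply: contraNneq => ->; rewrite dvdz0. Qed.

Lemma coprime_prime_fact (p n : nat) : prime p -> (n < p)%N -> coprime p n`!.
Proof.
move=> p_pr; elim: n => [|n IHn] ltnp; first by rewrite fact0 coprimen1.
rewrite factS coprimeMr IHn ?(ltnW ltnp) // andbT prime_coprime //.
by rewrite gtnNdvd.
Qed.

Lemma chinese_primes (r : nat -> int) (n : nat) :
  exists2 w : int, w != 0 &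
    forall p : nat, prime p -> (p < n)%N -> (p %| w - r p)%Z.
Proof.
have fact_dvd m (q : nat) : prime q -> (q < m)%N -> (q %| (m.-1)`!%:Z)%Z.
  by case: m => // m pq ltqm; rewrite dvdzE dvdn_fact // prime_gt0.
suff [w w_r] : exists w : int,
    forall p : nat, prime p -> (p < n)%N -> (p %| w - r p)%Z.
  (* If the solution at hand is zero, replace it by a nonzero multiple of all
     the moduli. *)
  case: (eqVneq w 0) => [w0|w_neq0]; last by exists w.
  exists (n.-1)`!%:Z; first by rewrite -lt0n fact_gt0.
  move=> p p_pr ltpn.
  apply: (dvdz_lincomb 1 1 (fact_dvd _ _ p_pr ltpn) (w_r _ p_pr ltpn)).
  by rewrite w0; ring.
elim: n => [|n [w w_r]]; first by exists 0.
case n_pr : (prime n); last first.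
  exists w => p p_pr; rewrite ltnS leq_eqVlt => /predU1P[pn|]; last exact: w_r.
  by rewrite pn n_pr in p_pr.
have co : coprimez (n.-1)`!%:Z n.
  by rewrite coprimezE coprime_sym coprime_prime_fact // prednK ?prime_gt0.
exists (zchinese (n.-1)`! n w (r n)) => p p_pr.
rewrite ltnS leq_eqVlt => /predU1P[->|ltpn].
  by rewrite -eqz_mod_dvd; apply/eqP/zchinese_modr.
have /eqP := zchinese_modl co w (r n); rewrite eqz_mod_dvd => dfact.
apply: (dvdz_lincomb 1 1 (dvdz_trans (fact_dvd _ _ p_pr ltpn) dfact)
  (w_r _ p_pr ltpn)); ring.
Qed.

(** * Neighbourhoods and their closures *)

(** The intersection of the subbasic cosets through [x] of modulus below [n];
    as [n] grows, these sets form a base of neighbourhoods of [x]. *)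
Definition kirch_nbhd (n : nat) (x : kirchZ) : set kirchZ :=
  [set z | forall p : nat, prime p -> (p < n)%N ->
     ~~ (p %| val x)%Z -> (p %| val z - val x)%Z].

Lemma nonzero_kirch (z : int) : z != 0 -> exists x : kirchZ, val x = z.
Proof. by move=> z0; exists (exist _ z z0). Qed.

Lemma kirch_nbhd_sub (m n : nat) (x : kirchZ) : (m <= n)%N ->
  kirch_nbhd n x `<=` kirch_nbhd m x.
Proof. by move=> lemn z zx p p_pr ltpm; apply: zx (leq_trans ltpm lemn). Qed.

Lemma open_kirch_subbase (U : set kirchZ) : kirch_subbase U -> open U.
Proof.
move=> sU; exists [set U]; last by rewrite bigcup_set1.
move=> _ ->; exact: (@finI_from1 _ _ kirch_subbase id).
Qed.

Lemma nbhs_kirch_coset (x : kirchZ) (p : nat) : prime p ->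
  ~~ (p %| val x)%Z -> nbhs x [set z | (p %| val z - val x)%Z].
Proof.
move=> p_pr px; rewrite nbhsE; exists (kirch_coset x p).
  split; first by apply: open_kirch_subbase; exists x, p.
  by exists 0; rewrite mulr0 addr0.
by move=> z [n zE] /=; rewrite zE addrC addKr dvdz_mulr.
Qed.

Lemma nbhs_kirchE (x : kirchZ) (A : set kirchZ) :
  nbhs x A <-> exists n, kirch_nbhd n x `<=` A.
Proof.
split.
  rewrite nbhsE => -[B [[D D_sub <-] [C DC Cx]] BA].
  have [F F_sub CE] := D_sub _ DC.
  suff [n nF] : exists n, forall U,
      U \in finmap.enum_fset F -> kirch_nbhd n x `<=` U.
    exists n; apply: subset_trans BA => z zx; exists C => //; change (C z).
    by rewrite -CE => U FU; apply: nF zx.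
  have {F_sub CE} : forall U,
      U \in finmap.enum_fset F -> kirch_subbase U /\ U x.
    by move=> U FU; split; [exact/set_mem/F_sub | move: Cx; rewrite -CE; apply].
  elim: (finmap.enum_fset F) => [|U s IHs] sP; first by exists 0%N.
  have [|n ns] := IHs; first by move=> V sV; apply: sP; rewrite in_cons sV orbT.
  have [[a [p [p_pr pa UE]]] Ux] := sP U (mem_head _ _).
  exists (maxn n p.+1) => V; rewrite in_cons => /predU1P[->|/ns]; last first.
    by apply: subset_trans; apply: kirch_nbhd_sub; rewrite leq_maxl.
  move=> z /(_ p p_pr); rewrite leq_max ltnSn orbT => /(_ isT).
  move: Ux; rewrite UE => -[m xE].
  have -> : (p %| val x)%Z = (p %| val a)%Z.
    by rewrite xE rpredDr // dvdz_mulr.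
  by move=> /(_ pa)/dvdzP[k zE]; exists (m + k);
    rewrite mulrDr addrA -xE [_ * k]mulrC -zE addrC subrK.
case=> n nA; apply: filterS nA _; elim: n => [|n IHn].
  by apply: filterS filterT => z _ p.
have nC : nbhs x [set z | prime n -> ~~ (n %| val x)%Z ->
    (n %| val z - val x)%Z].
  case n_pr : (prime n); last by apply: filterS filterT.
  case nx : (n %| val x)%Z; first by apply: filterS filterT.
  apply: filterS (nbhs_kirch_coset n_pr (negbT nx)) => z nzx _ _; exact: nzx.
apply: filterS (filterI nC IHn) => z [nz zx] p p_pr.
rewrite ltnS leq_eqVlt => /predU1P[pn|ltpn]; last exact: zx.
by rewrite pn in p_pr *; apply: nz.
Qed.

(** If [z] is nonzero modulo [p], then [z + pZ] is a neighbourhood of [z], which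
    meets [x + pZ] only if [z = x] modulo [p]; if [p] divides [z], then no
    neighbourhood of [z] restricts the residue modulo [p]. *)
Lemma closure_kirch_nbhd (n : nat) (x z : kirchZ) :
  closure (kirch_nbhd n x) z <->
  (forall p : nat, prime p -> (p < n)%N -> ~~ (p %| val x)%Z ->
     (p %| val z * (val z - val x))%Z).
Proof.
split=> [zx p p_pr ltpn px | zx B].
  rewrite Euclid_dvdzM //; case: (boolP (_ %| val _)%Z) => //= pz.
  have [w [wx wz]] := zx _ (nbhs_kirch_coset p_pr pz).
  by apply: (dvdz_lincomb 1 (-1) (wx p p_pr ltpn px) wz); ring.
move=> /nbhs_kirchE[m mB].
(* The residues prescribed by the neighbourhood of [x], and those of [z] at the
   other primes. *)
pose r (p : nat) := if (p < n)%N && ~~ (p %| val x)%Z then val x else val z.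
have [w w0 wr] := chinese_primes r (maxn m n).
have [t tw] := nonzero_kirch w0.
exists t; split; last apply: mB.
  move=> p p_pr ltpn px; rewrite tw.
  by have := wr p p_pr; rewrite /r ltpn px leq_max ltpn orbT => ->.
move=> p p_pr ltpm pz; rewrite tw.
have := wr p p_pr; rewrite leq_max ltpm /r => /(_ isT).
case: ifP => // /andP[ltpn px] pw.
have := zx p p_pr ltpn px; rewrite Euclid_dvdzM // (negbTE pz) /= => pzx.
by apply: (dvdz_lincomb 1 (-1) pw pzx); ring.
Qed.

(** * Hulls of finite sets *)

(** A closure operator on finite sets: the closed neighbourhoods of the points
    of the hull belong to the filter generated by the intersections of closed
    neighbourhoods of all the points of [E]. *)
Definition nbhs_hull (T : topologicalType) (E : seq T) : set T :=
  [set x | forall U, nbhs x U -> exists V : T -> set T,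
     (forall e, e \in E -> nbhs e (V e)) /\
     (forall z, (forall e, e \in E -> closure (V e) z) -> closure U z)].

Lemma closure_preimage (T U : topologicalType) (f : T -> U) (A : set U)
    (z : T) :
  continuous f -> closure (f @^-1` A) z -> closure A (f z).
Proof. by move=> cf zA B /cf/zA[t [At Bt]]; exists (f t). Qed.

Lemma homeomorphism_hull (T U : topologicalType) (f : T -> U) (g : U -> T)
    (E : seq T) (x : T) :
  continuous f -> continuous g -> cancel f g -> cancel g f ->
  nbhs_hull E x -> nbhs_hull (map f E) (f x).
Proof.
move=> cf cg fK gK xE W /cf/xE[V [nV VW]].
exists (fun y => g @^-1` V (g y)); split=> [_ /mapP[e eE ->]|z zV].
  by apply: cg; rewrite fK; apply: nV.
rewrite -[z]gK; apply: (closure_preimage cf); apply: VW => e eE.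
apply: (closure_preimage cg); have := zV (f e) (map_f f eE); rewrite fK; exact.
Qed.

(** Closed neighbourhoods of [e] see, modulo each prime [p] that does not divide
    [e], only whether a point is congruent to [0] or to [e]. The primes being
    independent, the hull is described by one condition at each: a residue [z]
    allowed by all the points of [E] must be allowed by [x]. *)
Lemma kirch_hullE (E : seq kirchZ) (x : kirchZ) :
  nbhs_hull E x <->
  (forall (p : nat) (z : int), prime p ->
     (forall e, e \in E -> (p %| val e * (z * (z - val e)))%Z) ->
     (p %| val x * (z * (z - val x)))%Z).
Proof.
split=> [xE p z p_pr zE | xE U /nbhs_kirchE[n nU]]; last first.
  exists (kirch_nbhd n); split=> [e _|z zE].
    by apply/nbhs_kirchE; exists n.
  apply: (closureS nU); apply/closure_kirch_nbhd => p p_pr ltpn px.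
  have := xE p (val z) p_pr; rewrite Euclid_dvdzM // (negbTE px) orFb.
  move=> -> // e eE.
  rewrite Euclid_dvdzM //; case: (boolP (_ %| val _)%Z) => //= pe.
  by move/closure_kirch_nbhd: (zE e eE) => ->.
rewrite Euclid_dvdzM //; case: (boolP (_ %| val _)%Z) => //= px.
have [V [nV VU]] : exists V : kirchZ -> set kirchZ,
    (forall e, e \in E -> nbhs e (V e)) /\
    (forall z, (forall e, e \in E -> closure (V e) z) ->
      closure (kirch_nbhd p.+1 x) z).
  by apply: xE; apply/nbhs_kirchE; exists p.+1.
have [m mV] : exists m, forall e, e \in E -> kirch_nbhd m e `<=` V e.
  elim: E {xE zE VU} nV => [|e E IHE] nV; first by exists 0%N.
  have [k kV] : exists k, kirch_nbhd k e `<=` V e.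
    by apply/nbhs_kirchE; apply: nV; rewrite mem_head.
  have [|m mV] := IHE; first by move=> a aE; apply: nV; rewrite in_cons aE orbT.
  exists (maxn k m) => a; rewrite in_cons => /predU1P[->|aE].
    by apply: subset_trans kV; apply: kirch_nbhd_sub; rewrite leq_maxl.
  by apply: subset_trans (mV a aE); apply: kirch_nbhd_sub; rewrite leq_maxr.
(* A point congruent to [z] modulo [p] and divisible by the other small primes
   lies in the closures of all the [V e], hence in that of the neighbourhood of
   [x], which restricts its residue modulo [p]. *)
have [w w0 wr] :=
  chinese_primes (fun q => if q == p then z else 0) (maxn p.+1 m).
have [t tw] := nonzero_kirch w0.
have pwz : (p %| w - z)%Z.
  by have := wr p p_pr; rewrite eqxx leq_max ltnSn => ->.
have : closure (kirch_nbhd p.+1 x) t.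
  apply: VU => e eE; apply: (closureS (mV e eE)).
  apply/closure_kirch_nbhd => q q_pr ltqm qe; rewrite tw.
  have := wr q q_pr; rewrite leq_max ltqm orbT => /(_ isT).
  case: eqP => [qp _|_]; last by rewrite subr0 => qw; rewrite dvdz_mulr.
  rewrite qp in qe *; have := zE e eE; rewrite Euclid_dvdzM // (negbTE qe) /=.
  move=> pze.
  by apply: (dvdz_lincomb (w + z - val e) 1 pwz pze); ring.
move/closure_kirch_nbhd/(_ p p_pr (ltnSn p) px); rewrite tw => pwx.
by apply: (dvdz_lincomb (-(w + z - val x)) 1 pwz pwx); ring.
Qed.

(** * Maximal proper hulls *)

(** For [p] prime, the union of [pZ] and [k + pZ]; it is the closure of [k + pZ]
    if moreover [p] does not divide [k]. *)
Definition coset0 (p : nat) (k : int) : set kirchZ :=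
  [set z | (p %| val z * (val z - k))%Z].

Lemma odd_prime_ndvd2 (p : nat) : prime p -> odd p -> ~~ (p %| 2)%Z.
Proof.
by move=> p_pr p_odd; rewrite dvdz_prime2 //; case: eqP p_odd => // ->.
Qed.

Lemma ndvdz_double (p : nat) (k : int) : prime p -> odd p ->
  ~~ (p %| k)%Z -> ~~ (p %| 2 * k)%Z.
Proof.
by move=> p_pr p_odd pk; rewrite Euclid_dvdzM // negb_or odd_prime_ndvd2.
Qed.

Lemma coset0_proper (p : nat) (k : int) : prime p -> odd p ->
  ~~ (p %| k)%Z -> exists x, ~ coset0 p k x.
Proof.
move=> p_pr p_odd pk; have p2k := ndvdz_double p_pr p_odd pk.
(* As [p] is odd, [2 k] is a third residue besides [0] and [k]. *)
have [x xE] := nonzero_kirch (ndvdz_neq0 p2k).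
exists x; rewrite /coset0 /= xE Euclid_dvdzM // (negbTE p2k) /=.
apply/negP; rewrite (_ : 2 * k - k = k) //; ring.
Qed.

Lemma coset0_congr (p : nat) (k l : int) (x : kirchZ) : (p %| k - l)%Z ->
  coset0 p k x -> coset0 p l x.
Proof.
by move=> pkl xk; apply: (dvdz_lincomb (val x) 1 pkl xk); ring.
Qed.

(** At the prime two the condition describing hulls is void, since the only
    residues are [0] and [1]. *)
Lemma even_triple (q : nat) (x z : int) : prime q -> ~~ odd q ->
  (q %| x * (z * (z - x)))%Z.
Proof.
move=> q_pr; case: (even_prime q_pr) => -> // _; rewrite !Euclid_dvdzM //.
have [x2|x2] : (x %% 2)%Z = 0 \/ (x %% 2)%Z = 1 by lia.
  by apply/orP; left; apply/dvdz_mod0P.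
have [z2|z2] : (z %% 2)%Z = 0 \/ (z %% 2)%Z = 1 by lia.
  by apply/or3P/Or32/dvdz_mod0P.
by apply/or3P/Or33/dvdz_mod0P; lia.
Qed.

(** Three points [k], [k + p], [k + 2 p] are congruent to [k] modulo [p], while
    at every other odd prime [q] two of them have distinct nonzero residues, so
    that only the residue [0] is allowed there by all of them. *)
Lemma coset0_hull (p : nat) (k : int) : prime p -> odd p -> ~~ (p %| k)%Z ->
  exists E, nbhs_hull E = coset0 p k.
Proof.
move=> p_pr p_odd pk.
have shift (i : int) : exists e : kirchZ, val e = k + i * p.
  apply: nonzero_kirch; apply: (@ndvdz_neq0 p); apply: contra pk => pki.
  by apply: (dvdz_lincomb 1 (- i) pki (dvdzz p)); ring.
have [e0 e0E] := shift 0; have [e1 e1E] := shift 1; have [e2 e2E] := shift 2.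
exists [:: e0; e1; e2]; apply/seteqP; split=> x; rewrite /coset0 /=.
  move=> /kirch_hullE/(_ p k p_pr) xE.
  have : (p %| val x * (k * (k - val x)))%Z.
    apply: xE => e; rewrite !inE => /or3P[] /eqP ->; rewrite ?e0E ?e1E ?e2E;
      do 2![apply: dvdz_mull]; by rewrite opprD addNKr rpredN dvdz_mull.
  rewrite !Euclid_dvdzM // (negbTE pk) /= => /orP[->//|pkx].
  by apply/orP; right; apply: (dvdz_lincomb (-1) 0 pkx pkx); ring.
move=> xk; apply/kirch_hullE => q z q_pr zE.
have := zE e0; have := zE e1; have := zE e2; rewrite !inE !eqxx !orbT /=.
move=> /(_ isT) z2 /(_ isT) z1 /(_ isT) z0 {zE}.
rewrite {}e0E in z0; rewrite {}e1E in z1; rewrite {}e2E in z2.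
have [q_odd|/even_triple-> //] := boolP (odd q).
have [qp|q_neq_p] := eqVneq q p.
  rewrite {}qp in z0 *; move: z0; rewrite mul0r addr0.
  rewrite Euclid_dvdzM // (negbTE pk) /= => pzk.
  case: (boolP (p %| val x)%Z) => [px|px]; first by rewrite dvdz_mulr.
  move: xk; rewrite Euclid_dvdzM // (negbTE px) /= => xk.
  by apply: (dvdz_lincomb (val x) (- (val x * z)) pzk xk); ring.
case: (boolP (q %| z)%Z) => [qz|qz]; first by rewrite dvdz_mull // dvdz_mulr.
(* If [z] were nonzero modulo [q], it would be a root of [e * (z - e)] for three
   values of [e] in arithmetic progression; the differences of these three
   conditions force [q] to divide the step [p]. *)
exfalso; move: z0 z1 z2.
rewrite 3!(mulrCA _ z) !(Euclid_dvdzM z) // (negbTE qz) /=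
   mul0r addr0 mul1r => z0 z1 z2.
have qNp : ~~ (q %| p%:Z)%Z by rewrite dvdz_prime2.
have : (q %| p%:Z * (z - 2 * k - p%:Z))%Z.
  by apply: (dvdz_lincomb 1 (-1) z1 z0); ring.
rewrite Euclid_dvdzM // (negbTE qNp) /= => d1.
have : (q %| 2 * (p%:Z * (z - 2 * k - 2 * p%:Z)))%Z.
  by apply: (dvdz_lincomb 1 (-1) z2 z0); ring.
rewrite !Euclid_dvdzM // (negbTE qNp) (negbTE (odd_prime_ndvd2 _ _)) //= => d2.
by move/negP: qNp; apply; apply: (dvdz_lincomb 1 (-1) d1 d2); ring.
Qed.

(** A point outside the hull violates the condition of [kirch_hullE] at some
    prime [p] and residue [k]; the condition at that [p] and [k] confines the
    whole hull to [coset0 p k]. *)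
Lemma hull_sub_coset0 (E : seq kirchZ) : (exists x, ~ nbhs_hull E x) ->
  exists (p : nat) (k : int),
    [/\ prime p, odd p, ~~ (p %| k)%Z & nbhs_hull E `<=` coset0 p k].
Proof.
case=> x /kirch_hullE/existsNP[p /existsNP[k /not_implyP[p_pr]]].
move=> /not_implyP[kE /negP pxk].
have p_odd : odd p by apply: contraNT pxk; exact: even_triple.
have pk : ~~ (p %| k)%Z.
  by apply: contra pxk => pk; rewrite dvdz_mull // dvdz_mulr.
exists p, k; split=> // y /kirch_hullE/(_ p k p_pr kE).
rewrite /coset0 /= !Euclid_dvdzM // (negbTE pk) /= => /orP[->//|pky].
by apply/orP; right; apply: (dvdz_lincomb (-1) 0 pky pky); ring.
Qed.

Lemma coset0_subset (p q : nat) (k l : int) : prime p -> prime q -> odd q ->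
    ~~ (p %| k)%Z -> ~~ (q %| l)%Z -> coset0 p k `<=` coset0 q l ->
  p = q /\ (p %| k - l)%Z.
Proof.
move=> p_pr q_pr q_odd pk ql sub.
have [eqpq|neqpq] := eqVneq p q.
  split=> //; have [x xE] := nonzero_kirch (ndvdz_neq0 pk).
  have : coset0 p k x by rewrite /coset0 /= xE subrr mulr0 dvdz0.
  by move=> /sub; rewrite /coset0 /= xE -eqpq Euclid_dvdzM // (negbTE pk).
(* For distinct primes, the point [0] modulo [p] and [2 l] modulo [q] is in the
   first set only. *)
have [w w0 wr] :=
  chinese_primes (fun n => if n == p then 0 else 2 * l) (maxn p q).+1.
have [x xE] := nonzero_kirch w0.
have := wr p p_pr; rewrite eqxx subr0 ltnS leq_maxl => /(_ isT) pw.
have := wr q q_pr; rewrite eq_sym (negbTE neqpq) ltnS leq_maxr => /(_ isT) qw.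
have /sub : coset0 p k x by rewrite /coset0 /= xE dvdz_mulr.
rewrite /coset0 /= xE => qwl; have := ndvdz_double q_pr q_odd ql.
have : (q %| (2 * l) * l)%Z.
  by apply: (dvdz_lincomb (-(w + l)) 1 qw qwl); ring.
by rewrite Euclid_dvdzM // (negbTE ql) orbF => ->.
Qed.

Definition homeo_pair (T U : topologicalType) (f : T -> U) (g : U -> T) :=
  [/\ continuous f, continuous g, cancel f g & cancel g f].

Lemma homeo_pair_sym (T U : topologicalType) (f : T -> U) (g : U -> T) :
  homeo_pair f g -> homeo_pair g f.
Proof. by case. Qed.

Lemma homeo_pair_hull (T U : topologicalType) (f : T -> U) (g : U -> T)
    (E : seq T) (x : T) :
  homeo_pair f g -> nbhs_hull (map f E) (f x) <-> nbhs_hull E x.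
Proof.
case=> cf cg fK gK; split; last exact: homeomorphism_hull gK.
by move=> /(homeomorphism_hull cg cf gK fK); rewrite fK mapK.
Qed.

(** The image of [coset0 p k] is a proper hull, so it lies in some [coset0 q l];
    the preimage of the latter is a proper hull too, so it lies in some
    [coset0 r m]. Then [coset0 p k] is contained in [coset0 r m], hence equal to
    it, and the two inclusions are equalities. *)
Lemma homeo_coset0 (f g : kirchZ -> kirchZ) (p : nat) (k : int) :
    homeo_pair f g -> prime p -> odd p -> ~~ (p %| k)%Z ->
  exists (q : nat) (l : int), [/\ prime q, odd q, ~~ (q %| l)%Z &
    forall x, coset0 p k x <-> coset0 q l (f x)].
Proof.
move=> fg p_pr p_odd pk; have gf := homeo_pair_sym fg.
have [E EE] := coset0_hull p_pr p_odd pk.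
have [|q [l [q_pr q_odd ql fE_sub]]] := @hull_sub_coset0 (map f E).
  have [x xk] := coset0_proper p_pr p_odd pk.
  by exists (f x); rewrite (homeo_pair_hull _ _ fg) EE.
have [E' E'E] := coset0_hull q_pr q_odd ql.
have [|r [m [r_pr r_odd rm gE_sub]]] := @hull_sub_coset0 (map g E').
  have [x xl] := coset0_proper q_pr q_odd ql.
  by exists (g x); rewrite (homeo_pair_hull _ _ gf) E'E.
have fcoset x : coset0 p k x -> coset0 q l (f x).
  by rewrite -EE -(homeo_pair_hull E x fg); apply: fE_sub.
have gcoset x : coset0 q l (f x) -> coset0 r m x.
  case: (fg) => _ _ fK _; rewrite -E'E -(homeo_pair_hull E' _ gf) fK.
  exact: gE_sub.
have [pr pkm] := coset0_subset p_pr r_pr r_odd pk rm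
  (fun x xk => gcoset x (fcoset x xk)).
exists q, l; split=> // x; split; first exact: fcoset.
move/gcoset; rewrite -pr; apply: coset0_congr.
by apply: (dvdz_lincomb (-1) 0 pkm pkm); ring.
Qed.

(** * Congruences modulo odd primes are topological *)

(** The images of the sets [coset0 p k], for [0 < k < p], are finitely many sets
    of the same kind and they cover the space. If for each odd prime [q] some
    nonzero residue [R q] were missing among the images of modulus [q], then a
    point congruent to [R q] modulo all the [q] involved would not be covered. *)
Lemma homeo_cover (f g : kirchZ -> kirchZ) (p : nat) :
    homeo_pair f g -> prime p -> odd p ->
  exists q : nat, [/\ prime q, odd q & forall r : int, ~~ (q %| r)%Z ->
    exists2 k : int, ~~ (p %| k)%Z &
      forall x, coset0 p k x <-> coset0 q r (f x)].
Proof.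
move=> fg p_pr p_odd; apply: contrapT => /forallNP noq.
have p_gt1 := prime_gt1 p_pr.
have small_ndvd k : (0 < k < p)%N -> ~~ (p %| k%:Z)%Z.
  by case/andP=> k0 kp; rewrite dvdzE gtnNdvd.
have /choice[F FP] (k : nat) : exists u : nat * int, (0 < k < p)%N ->
    [/\ prime u.1, odd u.1, ~~ (u.1 %| u.2)%Z &
      forall x, coset0 p k x <-> coset0 u.1 u.2 (f x)].
  have [kp|] := boolP (0 < k < p)%N; last by exists (0%N, 0).
  have [q [l ql]] := homeo_coset0 fg p_pr p_odd (small_ndvd k kp).
  by exists (q, l).
have /choice[R RP] (q : nat) : exists r : int, prime q -> odd q ->
    ~~ (q %| r)%Z /\ forall k : int, ~~ (p %| k)%Z ->
      ~ (forall x, coset0 p k x <-> coset0 q r (f x)).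
  have [q_pr|] := boolP (prime q); last by exists 0.
  have [q_odd|] := boolP (odd q); last by exists 0.
  apply: contrapT => /forallNP nor; apply: (noq q); split=> // r qr.
  apply: contrapT => nok; apply: (nor r) => _ _; split=> // k pk kr.
  by apply: nok; exists k.
have [w w0 wR] := chinese_primes R (\max_(k < p) (F k).1).+1.
have [t tE] := nonzero_kirch w0.
(* The class of [g t] modulo [p], or any nonzero class if it is zero. *)
have [k kp kgt] : exists2 k, (0 < k < p)%N & coset0 p k (g t).
  case: (boolP (p %| val (g t))%Z) => [pgt|pgt].
    by exists 1%N; [rewrite p_gt1 | rewrite /coset0 /= dvdz_mulr].
  have p_neq0 : p%:Z != 0 by rewrite eqz_nat -lt0n ltnW.
  exists `|(val (g t) %% p)%Z|%N.
    apply/andP; split.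
      by rewrite absz_gt0; apply: contra pgt => /eqP/dvdz_mod0P.
    by rewrite -ltz_nat gez0_abs ?modz_ge0 // ltz_pmod // ltz_nat ltnW.
  rewrite /coset0 /= gez0_abs ?modz_ge0 // dvdz_mull //.
  by rewrite {1}(divz_eq (val (g t)) p) addrK dvdz_mull.
have [q_pr q_odd ql kl] := FP k kp; set q := (F k).1 in q_pr q_odd ql kl.
have [qR noR] := RP q q_pr q_odd.
have qwR : (q %| w - R q)%Z.
  have /andP[_ kltp] := kp; apply: wR => //; rewrite ltnS.
  exact: (@leq_bigmax _ (fun i : 'I_p => (F i).1) (Ordinal kltp)).
have qw : ~~ (q %| w)%Z.
  by apply: contra qR => qw; apply: (dvdz_lincomb 1 (-1) qw qwR); ring.
have /kl := kgt; case: (fg) => _ _ _ ->; rewrite /coset0 /= tE.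
rewrite Euclid_dvdzM // (negbTE qw) /= => qwl.
apply: (noR k (small_ndvd k kp)) => x; rewrite kl.
split; apply: coset0_congr.
  by apply: (dvdz_lincomb 1 (-1) qwR qwl); ring.
by apply: (dvdz_lincomb (-1) 1 qwR qwl); ring.
Qed.

(** Two points congruent modulo [p] belong to the same sets [coset0 p k], so
    their images belong to the same sets [coset0 q r]. Membership in these
    determines the residue modulo [q]: taking for [r] a residue and its double
    separates [0], [r] and all the rest. *)
Lemma homeo_congr (f g : kirchZ -> kirchZ) (p : nat) :
    homeo_pair f g -> prime p -> odd p ->
  exists q : nat, [/\ prime q, odd q,
    forall x, (p %| val x)%Z -> (q %| val (f x))%Z &
    forall x y, (p %| val x - val y)%Z -> (q %| val (f x) - val (f y))%Z].
Proof.
move=> fg p_pr p_odd; have [q [q_pr q_odd cover]] := homeo_cover fg p_pr p_odd.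
exists q; split=> // [x px|x y pxy].
  apply/negPn/negP => qfx.
  have [k _ kx] := cover _ (ndvdz_double q_pr q_odd qfx).
  have /kx : coset0 p k x by rewrite /coset0 /= dvdz_mulr.
  rewrite /coset0 /= Euclid_dvdzM // (negbTE qfx) /= => qx.
  by case/negP: qfx; apply: (dvdz_lincomb (-1) 0 qx qx); ring.
have trans r a b : ~~ (q %| r)%Z -> (p %| val a - val b)%Z ->
    coset0 q r (f a) -> coset0 q r (f b).
  move=> qr pab; have [k _ kab] := cover r qr; rewrite -!kab /coset0 /= => pak.
  by apply: (dvdz_lincomb (-(val a + val b - k)) 1 pab pak); ring.
have half a b : (p %| val a - val b)%Z -> ~~ (q %| val (f a))%Z ->
    (q %| val (f a) - val (f b))%Z.
  move=> pab qfa.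
  have : coset0 q (val (f a)) (f b).
    by apply: (trans _ a) => //; rewrite /coset0 /= subrr mulr0 dvdz0.
  rewrite /coset0 /= Euclid_dvdzM // => /orP[qfb|qfba]; last first.
    by apply: (dvdz_lincomb (-1) 0 qfba qfba); ring.
  have pba : (p %| val b - val a)%Z.
    by apply: (dvdz_lincomb (-1) 0 pab pab); ring.
  have := trans _ _ _ (ndvdz_double q_pr q_odd qfa) pba.
  rewrite /coset0 /= dvdz_mulr // => /(_ isT).
  rewrite Euclid_dvdzM // (negbTE qfa) /= => qd.
  by case/negP: qfa; apply: (dvdz_lincomb (-1) 0 qd qd); ring.
case: (boolP (q %| val (f x))%Z) => [qfx|]; last exact: half.
case: (boolP (q %| val (f y))%Z) => [qfy|]; first by rewrite rpredB.
have pyx : (p %| val y - val x)%Z by apply: (dvdz_lincomb (-1) 0 pxy pxy); ring.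
move/(half _ _ pyx) => qyx.
by apply: (dvdz_lincomb (-1) 0 qyx qyx); ring.
Qed.

(** The values [1], ..., [q] are pairwise incongruent modulo [q], so their images
    are pairwise incongruent modulo [p]. *)
Lemma congr_reflect_leq (h : kirchZ -> kirchZ) (p q : nat) : (0 < p)%N ->
    (forall x y, (p %| val (h x) - val (h y))%Z -> (q %| val x - val y)%Z) ->
  (q <= p)%N.
Proof.
move=> p_gt0 hP; have p_neq0 : p%:Z != 0 by rewrite eqz_nat -lt0n.
pose e (i : 'I_q) : kirchZ := exist _ i.+1%:Z isT.
have bound (i : 'I_q) : (`|(val (h (e i)) %% p)%Z| < p)%N.
  by rewrite -ltz_nat gez0_abs ?modz_ge0 // ltz_pmod.
suff /leq_card : injective (fun i => Ordinal (bound i)) by rewrite !card_ord.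
move=> i j [] eij; apply/val_inj.
have : (val (h (e i)) %% p)%Z = (val (h (e j)) %% p)%Z.
  by rewrite -[LHS]gez0_abs ?modz_ge0 // -[RHS]gez0_abs ?modz_ge0 // eij.
move=> /eqP; rewrite eqz_mod_dvd => /hP /=; rewrite -eqz_mod_dvd => /eqP.
rewrite !modz_nat => -[/eqP].
by rewrite -(addn1 i) -(addn1 j) eqn_modDr !modn_small // => /eqP.
Qed.

(** Congruence modulo [p] implies congruence modulo [q] of the images under [f],
    which implies congruence modulo some [r] of the points themselves; then
    [r = p], so [f] identifies the classes modulo [p] with those modulo [q], and
    counting them yields [q = p]. *)
Lemma homeo_dvdz (f g : kirchZ -> kirchZ) (p : nat) :
    homeo_pair f g -> prime p -> odd p ->
  (forall x, (p %| val x)%Z -> (p %| val (f x))%Z) /\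
  (forall x y, (p %| val x - val y)%Z -> (p %| val (f x) - val (f y))%Z).
Proof.
move=> fg p_pr p_odd; have gf := homeo_pair_sym fg.
have [_ _ fK gK] := fg.
have [q [q_pr q_odd f0 fP]] := homeo_congr fg p_pr p_odd.
have [r [r_pr r_odd _ gP]] := homeo_congr gf q_pr q_odd.
have rp : r = p.
  (* Two points at distance [p]. *)
  have one (a : nat) : exists x : kirchZ, val x = 1 + a%:Z.
    exact: nonzero_kirch.
  have [x xE] := one 0%N; have [y yE] := one p.
  have yx : val y - val x = p%:Z by rewrite xE yE; ring.
  have /fP/gP : (p %| val y - val x)%Z by rewrite yx.
  by rewrite !fK yx dvdz_prime2 // => /eqP.
rewrite rp in gP; suff qp : q = p by rewrite qp in f0 fP.
apply/eqP; rewrite eqn_leq; apply/andP; split.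
  apply: (@congr_reflect_leq g); first exact: prime_gt0.
  by move=> x y /fP; rewrite !gK.
apply: (@congr_reflect_leq f); first exact: prime_gt0.
by move=> x y /gP; rewrite !fK.
Qed.

(** * Integer maps preserving congruences modulo odd primes *)

Definition odd_prime_free (z : int) :=
  forall p : nat, prime p -> odd p -> ~~ (p %| z)%Z.

(** No odd prime divides [x], [y] or [x - y]; in particular these three integers
    are nonzero, as [3] divides [0]. *)
Definition adjacent (x y : int) := odd_prime_free (x * (y * (x - y))).

Lemma odd_prime_freeM (a b : int) :
  odd_prime_free (a * b) <-> odd_prime_free a /\ odd_prime_free b.
Proof.
split=> [ab|[a_free b_free] p p_pr p_odd].
  by split=> p p_pr p_odd; have := ab p p_pr p_odd;
    rewrite Euclid_dvdzM // => /norP[].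
by rewrite Euclid_dvdzM // negb_or a_free // b_free.
Qed.

Lemma odd_prime_freeN (a : int) : odd_prime_free a -> odd_prime_free (- a).
Proof. by move=> fa p p_pr p_odd; rewrite rpredN; apply: fa. Qed.

Lemma odd_prime_free2 : odd_prime_free 2.
Proof. exact: odd_prime_ndvd2. Qed.

Lemma odd_prime_free1 : odd_prime_free 1.
Proof.
by move=> p p_pr _; rewrite dvdzE dvdn1; apply: contraTneq p_pr => /= ->.
Qed.

Lemma odd_prime_freeP (z : int) : odd_prime_free z ->
  exists k : nat, z = 2 ^+ k \/ z = - 2 ^+ k.
Proof.
move=> fz; have z0 : z != 0 by have /ndvdz_neq0 := fz 3%N isT isT.
have /p_natP[k kE] : (2%N).-nat `|z|%N.
  apply/pnatP; first by rewrite absz_gt0.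
  move=> p p_pr pz; case: (even_prime p_pr) => [->//|p_odd].
  by have := fz p p_pr p_odd; rewrite dvdzE /= pz.
exists k; have := abszE z; rewrite kE; have [z_ge0|z_lt0] := ger0P z => zE.
  by left; rewrite -zE -natz natrX.
by right; rewrite -[z]opprK -zE -natz natrX.
Qed.

Lemma adjacent_opp (x : int) : odd_prime_free x -> adjacent x (- x).
Proof.
move=> fx; have fNx := odd_prime_freeN fx.
rewrite /adjacent opprK; do 2![apply/odd_prime_freeM; split=> //].
have -> : x + x = 2 * x by ring.
by apply/odd_prime_freeM; split=> //; exact: odd_prime_free2.
Qed.

Lemma adjacent_double (x : int) : odd_prime_free x -> adjacent x (2 * x).
Proof.
move=> fx; apply/odd_prime_freeM; split=> //; apply/odd_prime_freeM; split.
  by apply/odd_prime_freeM; split=> //; exact: odd_prime_free2.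
have -> : x - 2 * x = - x by ring.
exact: odd_prime_freeN.
Qed.

Lemma adjacent_sym (x y : int) : adjacent x y -> adjacent y x.
Proof.
move=> /odd_prime_freeN; rewrite /adjacent.
by have -> : - (x * (y * (x - y))) = y * (x * (y - x)) by ring.
Qed.

(** Neighbours are powers of two up to sign, and so is their difference. Removing
    the common power of two leaves [s - t * 2 ^ m] with signs [s] and [t]: for
    [m = 0] it is nonzero only if [t = - s], and for [m > 0] it is odd, so it is
    [1] or [-1], which forces [m = 1] and [t = s]. *)
Lemma adjacentP (x y : int) : adjacent x y ->
  [\/ y = - x, y = 2 * x | x = 2 * y].
Proof.
have main (i m : nat) (s t : int) : (s = 1 \/ s = -1) -> (t = 1 \/ t = -1) ->
    odd_prime_free (s * 2 ^+ i - t * 2 ^+ (i + m)) ->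
    t * 2 ^+ (i + m) = - (s * 2 ^+ i) \/ t * 2 ^+ (i + m) = 2 * (s * 2 ^+ i).
  move=> s1 t1; rewrite exprD => fst.
  have {fst} /odd_prime_freeM[_ fst] :
      odd_prime_free (2 ^+ i * (s - t * 2 ^+ m)).
    by have -> : 2 ^+ i * (s - t * 2 ^+ m) = s * 2 ^+ i - t * (2 ^+ i * 2 ^+ m)
      by ring.
  suff [E|E] : t * 2 ^+ m = - s \/ t * 2 ^+ m = 2 * s.
    by left; rewrite mulrCA E; ring.
    by right; rewrite mulrCA E; ring.
  have [k kE] := odd_prime_freeP fst.
  case: m kE {fst} => [|m]; first rewrite expr0 mulr1 => kE.
    left; have : (0 : int) < 2 ^+ k by rewrite exprn_gt0.
    by case: s1 t1 kE => -> [] -> [] ; lia.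
  rewrite exprS => kE; right.
  have : (0 : int) < 2 ^+ m by rewrite exprn_gt0.
  case: k kE => [|k]; rewrite ?expr0 ?exprS; move: (2 ^+ m : int) => P.
    by case: s1 t1 => -> [] ->; lia.
  by move: (2 ^+ k : int) => Q; case: s1 t1 => -> [] ->; lia.
move=> xy; have [fx /odd_prime_freeM[fy fxy]] := (odd_prime_freeM _ _).1 xy.
have [i xE] := odd_prime_freeP fx; have [j yE] := odd_prime_freeP fy.
have sgn (z : int) k : z = 2 ^+ k \/ z = - 2 ^+ k ->
    exists2 s : int, s = 1 \/ s = -1 & z = s * 2 ^+ k.
  by case=> ->; [exists 1; [left|ring] | exists (-1); [right|ring]].
have [s s1 {}xE] := sgn _ _ xE; have [t t1 {}yE] := sgn _ _ yE.
case: (leqP i j) => [leij|/ltnW leji].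
  rewrite -(subnKC leij) in yE; rewrite xE yE in fxy *.
  by case: (main _ _ _ _ s1 t1 fxy) => ->; [apply: Or31|apply: Or32].
move: fxy => /odd_prime_freeN; rewrite opprB => fyx.
rewrite -(subnKC leji) in xE; rewrite xE yE in fyx *.
case: (main _ _ _ _ t1 s1 fyx) => ->; [apply: Or31|by apply: Or33].
by rewrite opprK.
Qed.

Lemma prime_dvd_odd_part (n : nat) : (0 < n)%N ->
  exists m c : nat, odd m /\ n = (m * 2 ^ c)%N.
Proof.
case/(@pfactor_coprime 2 n isT) => m co nE; exists m, (logn 2 n).
by rewrite -coprime2n.
Qed.

(** The sequence [2 ^ k - x] has infinitely many prime divisors: write
    [2 ^ K - x = m * 2 ^ b] with [m] odd and [b < K], and let [d'] be the odd part
    of [d]. If [2 ^ e = 1 + m * d' * s] then [2 ^ (K + e) - x] is the product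
    of [m * 2 ^ b] and [1 + 2 ^ (K - b) * d' * s], whose second factor is odd,
    larger than one and prime to [d]. *)
Lemma exists_odd_prime_dvd (x d : int) : x != 0 -> d != 0 ->
  exists (k p : nat), [/\ prime p, odd p, (p %| 2 ^+ k - x)%Z & ~~ (p %| d)%Z].
Proof.
move=> x0 d0; pose K := `|x|%N.+1.
have xK : (`|x| < 2 ^ K)%N by apply: ltn_trans (ltn_expl _ _); rewrite ?leqnn.
have xKz : x < 2 ^+ K by move: xK; rewrite -ltz_nat -natrX natz; lia.
have N_gt0 : 0 < 2 ^+ K - x by rewrite subr_gt0.
have [m [b [m_odd NE]]] : exists m b : nat,
    odd m /\ `|2 ^+ K - x|%N = (m * 2 ^ b)%N.
  by apply: prime_dvd_odd_part; rewrite absz_gt0 gt_eqF.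
have [d' [c [d'_odd dE]]] : exists d' c : nat,
    odd d' /\ `|d|%N = (d' * 2 ^ c)%N.
  by apply: prime_dvd_odd_part; rewrite absz_gt0.
have {}NE : 2 ^+ K - x = m%:Z * 2 ^+ b.
  by rewrite -[LHS]gtz0_abs // NE PoszM -natrX natz.
have ltbK : (b < K)%N.
  rewrite ltnNge; apply/negP => leKb.
  have : (2 ^+ K %| x)%Z.
    have -> : x = 2 ^+ K - m%:Z * 2 ^+ b by rewrite -NE; ring.
    by rewrite rpredB // dvdz_mull // -(subnKC leKb) exprD dvdz_mulr.
  rewrite dvdzE abszX => /dvdn_leq; rewrite absz_gt0 => /(_ x0).
  by rewrite leqNgt xK.
have md'_odd : odd (m * d') by rewrite oddM m_odd.
have md'_gt0 : (0 < m * d')%N by case: (m * d')%N md'_odd.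
pose e := totient (m * d').
have [s sE] : exists s, (2 ^ e = 1 + m * d' * s)%N.
  have := @Euler_exp_totient 2 (m * d').
  rewrite coprime2n => /(_ md'_odd)/eqP.
  rewrite eqn_mod_dvd ?expn_gt0 // => /dvdnP[s sE].
  by exists s; rewrite mulnC -sE subnKC // expn_gt0.
have s_gt0 : (0 < s)%N.
  have : (1 < 2 ^ e)%N by rewrite -{1}(expn0 2) ltn_exp2l // totient_gt0.
  by rewrite sE; case: (s) => //; rewrite muln0.
pose u := (1 + 2 ^ (K - b) * (d' * s))%N.
have u_odd : odd u.
  by rewrite /u oddD oddM oddX subn_eq0 leqNgt ltbK.
have u_gt1 : (1 < u)%N.
  rewrite /u -{1}[1%N]addn0 ltn_add2l !muln_gt0 expn_gt0 s_gt0.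
  by case: (d') d'_odd.
have p_pr := pdiv_prime u_gt1; have pu := pdiv_dvd u.
exists (K + e)%N, (pdiv u); split=> //; first exact: dvdn_odd u_odd.
  have -> : 2 ^+ (K + e) - x = m%:Z * 2 ^+ b * u%:Z.
    have eZ : (2 : int) ^+ e = 1 + m%:Z * d'%:Z * s%:Z.
      by have := congr1 Posz sE; rewrite PoszD !PoszM -natrX natz.
    have uZ : u%:Z = 1 + 2 ^+ (K - b) * (d'%:Z * s%:Z).
      by rewrite /u PoszD !PoszM -[(2 ^ _)%N%:Z]natz natrX.
    rewrite exprD eZ uZ -{1}(subnKC (ltnW ltbK)) exprD.
    rewrite -(subnKC (ltnW ltbK)) exprD in NE.
    have -> : x = 2 ^+ b * 2 ^+ (K - b) - m%:Z * 2 ^+ b by rewrite -NE; ring.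
    ring.
  by rewrite dvdz_mull // dvdzE.
rewrite dvdzE dE Euclid_dvdM // negb_or; apply/andP; split.
  apply/negP => /= pd'; move: pu; rewrite /u dvdn_addl ?dvdn1 => [/eqP p1|].
    by rewrite p1 in p_pr.
  by rewrite dvdn_mull // dvdn_mulr.
apply/negP; rewrite Euclid_dvdX // => /andP[p2 _].
by have := dvdn_odd pu u_odd; move: p2; rewrite /= dvdn_prime2 // => /eqP ->.
Qed.

Definition odd_congr_invariant (F : int -> int) :=
  forall p : nat, prime p -> odd p ->
    forall x y, (p %| F x - F y)%Z = (p %| x - y)%Z.

Lemma odd_congr_invariant_inv (F G : int -> int) : cancel G F ->
  odd_congr_invariant F -> odd_congr_invariant G.
Proof. by move=> GK FP p p_pr p_odd x y; rewrite -(FP p) // !GK. Qed.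

Lemma adjacent_map (F : int -> int) (x y : int) : F 0 = 0 ->
  odd_congr_invariant F -> adjacent x y -> adjacent (F x) (F y).
Proof.
move=> F0 FP xy p p_pr p_odd; have := xy p p_pr p_odd.
have F0P z : (p %| F z)%Z = (p %| z)%Z.
  by rewrite -[F z]subr0 -[in F z - 0]F0 FP // subr0.
by rewrite !Euclid_dvdzM // !F0P FP.
Qed.

Lemma adjacent_free (x y : int) : adjacent x y -> odd_prime_free x.
Proof. by move=> /odd_prime_freeM[]. Qed.

(** The corners [1] and [-1] of the ladder have two neighbours, whereas every
    other vertex [v] has the three neighbours [- v], [2 v] and [v / 2], which the
    inverse [G] would bring back to neighbours of a corner. Surjectivity
    matters: doubling preserves all the congruences and moves the corners. *)
Lemma corner_map (F G : int -> int) (s : int) : F 0 = 0 -> G 0 = 0 ->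
    cancel F G -> cancel G F -> odd_congr_invariant F ->
    s = 1 \/ s = -1 ->
  F s = 1 \/ F s = -1.
Proof.
move=> F0 G0 FK GK FP s1; have GP := odd_congr_invariant_inv GK FP.
have fs : odd_prime_free s.
  by case: s1 => ->; [|apply: odd_prime_freeN]; exact: odd_prime_free1.
have fv : odd_prime_free (F s).
  exact: adjacent_free (adjacent_map F0 FP (adjacent_opp fs)).
have [[|k] kE] := odd_prime_freeP fv; first by rewrite expr0 in kE.
have [w wE] : exists w, F s = 2 * w.
  by case: kE => ->; rewrite exprS; [exists (2 ^+ k)|exists (- 2 ^+ k); ring].
have fw : odd_prime_free w.
  by move: fv; rewrite wE => /odd_prime_freeM[].
have nbr y : adjacent (F s) y -> G y = - s \/ G y = 2 * s.
  move=> /(adjacent_map G0 GP); rewrite FK.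
  case/adjacentP=> [->|->|sE]; [by left|by right|].
  by case: s1 sE => ->; lia.
have n1 := nbr _ (adjacent_opp fv); have n2 := nbr _ (adjacent_double fv).
have n3 : G w = - s \/ G w = 2 * s.
  by apply: nbr; rewrite wE; apply/adjacent_sym/adjacent_double.
have w0 : w != 0 by have /ndvdz_neq0 := fw 3%N isT isT.
have G_inj : injective G := can_inj GK.
have no12 : G (- F s) <> G (2 * F s) by move/G_inj; rewrite wE; lia.
have no13 : G (- F s) <> G w by move/G_inj; rewrite wE; lia.
have no23 : G (2 * F s) <> G w by move/G_inj; rewrite wE; lia.
by exfalso; case: n1 n2 n3 no12 no13 no23 => -> [] -> [] ->.
Qed.

(** The image of [2 x] is a neighbour of [e * x]. The neighbours [- (e * x)] and
    [e * x / 2], if the latter is an integer, are already the images of [- x] and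
    [x / 2], so [e * (2 * x)] is the only one left. *)
Lemma ladder_step (F : int -> int) (e x : int) : F 0 = 0 -> injective F ->
    odd_congr_invariant F -> e = 1 \/ e = -1 -> odd_prime_free x ->
    F x = e * x -> F (- x) = - (e * x) ->
    (forall w, x = 2 * w -> F w = e * w) ->
  F (2 * x) = e * (2 * x).
Proof.
move=> F0 F_inj FP e1 fx Fx FNx Fhalf.
have x0 : x != 0 by have /ndvdz_neq0 := fx 3%N isT isT.
have := adjacent_map F0 FP (adjacent_double fx).
case/adjacentP=> [E|->|E]; last 1 first.
- have [w xE] : exists w, x = 2 * w.
    by exists (e * F (2 * x)); rewrite mulrCA -E Fx; case: e1 => ->; ring.
  have : F (2 * x) = F w.
    rewrite (Fhalf w xE); move: E; rewrite Fx xE; case: e1 => ->; lia.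
  by move/F_inj; move: x0; rewrite xE; lia.
- by move: E; rewrite Fx -FNx => /F_inj; lia.
by rewrite Fx; ring.
Qed.

Lemma pow2_map (F G : int -> int) : F 0 = 0 -> G 0 = 0 ->
    cancel F G -> cancel G F -> odd_congr_invariant F ->
  exists2 e : int, e = 1 \/ e = -1 & forall k, F (2 ^+ k) = e * 2 ^+ k.
Proof.
move=> F0 G0 FK GK FP; have F_inj := can_inj FK.
have corner s := corner_map (s := s) F0 G0 FK GK FP.
have e1 := corner 1 (or_introl erefl); exists (F 1) => // k.
have FN1 : F (-1) = - F 1.
  have := corner (-1) (or_intror erefl).
  have : F (-1) <> F 1 by move/F_inj.
  by move: e1; lia.
suff [] : F (2 ^+ k) = F 1 * 2 ^+ k /\ F (- 2 ^+ k) = F 1 * - 2 ^+ k by [].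
have free n : odd_prime_free (2 ^+ n).
  elim: n => [|n IHn]; first exact: odd_prime_free1.
  by rewrite exprS; apply/odd_prime_freeM; split=> //; exact: odd_prime_free2.
elim/ltn_ind: k => -[|k] IHk; first by rewrite expr0 FN1 mulr1 mulrN1.
have [IHp IHn] := IHk k (ltnSn k).
rewrite exprS -mulrN.
split; apply: ladder_step => //; rewrite ?opprK ?IHp ?IHn ?mulrN ?opprK //.
- case: k IHk {IHp IHn} => [|k] IHk w; first by rewrite expr0; lia.
  have [IHp _] := IHk k (leqnSn k.+1).
  by rewrite exprS => kw; have -> : w = 2 ^+ k by lia.
- exact/odd_prime_freeN/free.
case: k IHk {IHp IHn} => [|k] IHk w; first by rewrite expr0; lia.
have [_ IHn] := IHk k (leqnSn k.+1).
by rewrite exprS => kw; have -> : w = - 2 ^+ k by lia.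
Qed.

(** An odd prime divisor of [2 ^ k - x] divides [e * 2 ^ k - F x], hence also
    [F x - e * x]; a fixed nonzero integer cannot be divisible by all the primes
    that arise when [k] varies. *)
Lemma odd_congr_rigid (F G : int -> int) : F 0 = 0 -> G 0 = 0 ->
    cancel F G -> cancel G F -> odd_congr_invariant F ->
  exists2 e : int, e = 1 \/ e = -1 & forall x, F x = e * x.
Proof.
move=> F0 G0 FK GK FP; have [e e1 F2] := pow2_map F0 G0 FK GK FP.
exists e => // x; have [->|x0] := eqVneq x 0; first by rewrite F0 mulr0.
apply/eqP; rewrite -subr_eq0; apply/negPn/negP => d0.
have [k [p [p_pr p_odd pkx pd]]] := exists_odd_prime_dvd x0 d0.
have := pkx; rewrite -(FP p) // F2 => pkFx; case/negP: pd.
by apply: (dvdz_lincomb (-1) e pkFx pkx); ring.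
Qed.

(** * Rigidity *)

Lemma homeo_pairP (T U : topologicalType) (f : T -> U) :
  homeomorphism f <-> exists g, homeo_pair f g.
Proof.
split=> [[cf [g [fK gK cg]]]|[g [cf cg fK gK]]]; first by exists g.
by split=> //; exists g.
Qed.

(** With the value [0] at [0], divisibility by [p] becomes a congruence between
    values like any other. *)
Definition extend0 (f : kirchZ -> kirchZ) (z : int) : int :=
  if insub z is Some x then val (f x) else 0.

Lemma extend0_val (f : kirchZ -> kirchZ) (x : kirchZ) :
  extend0 f (val x) = val (f x).
Proof. by rewrite /extend0 valK. Qed.

Lemma extend00 (f : kirchZ -> kirchZ) : extend0 f 0 = 0.
Proof. by rewrite /extend0 insubF. Qed.

Lemma extend0_cases (P : int -> Prop) :
  P 0 -> (forall x : kirchZ, P (val x)) -> forall z, P z.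
Proof.
by move=> P0 Px z; have [->//|/nonzero_kirch[x <-]] := eqVneq z 0.
Qed.

Lemma extend0K (f g : kirchZ -> kirchZ) : cancel f g ->
  cancel (extend0 f) (extend0 g).
Proof.
move=> fK; apply: extend0_cases => [|x]; rewrite ?extend00 //.
by rewrite !extend0_val fK.
Qed.

Lemma extend0_congr (f g : kirchZ -> kirchZ) : homeo_pair f g ->
  odd_congr_invariant (extend0 f).
Proof.
move=> fg p p_pr p_odd; have [_ _ fK _] := fg.
have [f0 fP] := homeo_dvdz fg p_pr p_odd.
have [g0 gP] := homeo_dvdz (homeo_pair_sym fg) p_pr p_odd.
have f0E x : (p %| val (f x))%Z = (p %| val x)%Z.
  by apply/idP/idP => [/g0|/f0//]; rewrite fK.
apply: extend0_cases => [|x]; apply: extend0_cases => [|y];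
  rewrite ?extend00 ?extend0_val ?sub0r ?subr0 ?rpredN ?f0E //.
by apply/idP/idP => [/gP|/fP//]; rewrite !fK.
Qed.

Lemma kirch_opp_subproof (x : kirchZ) : - val x != 0.
Proof. by rewrite oppr_eq0; exact: (valP x). Qed.

Definition kirch_opp (x : kirchZ) : kirchZ :=
  exist _ (- val x) (kirch_opp_subproof x).

Lemma kirch_oppK : involutive kirch_opp.
Proof. by move=> x; apply: val_inj; rewrite /= opprK. Qed.

Lemma continuous_kirch_opp : continuous kirch_opp.
Proof.
move=> x A /nbhs_kirchE[n nA]; apply/nbhs_kirchE; exists n => z zx; apply: nA.
by move=> p p_pr ltpn /=; rewrite rpredN -opprD rpredN; exact: zx.
Qed.

Lemma homeomorphism_kirchE (f : kirchZ -> kirchZ) :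
  homeomorphism f <-> f = id \/ f = kirch_opp.
Proof.
split=> [/homeo_pairP[g fg]|[]->]; last 2 first.
- by split=> [x|]; [exact: cvg_id|exists id; split=> // x; exact: cvg_id].
- by split; [exact: continuous_kirch_opp|exists kirch_opp; split;
    [exact: kirch_oppK|exact: kirch_oppK|exact: continuous_kirch_opp]].
have [_ _ fK gK] := fg.
have [e e1 fE] := odd_congr_rigid (extend00 f) (extend00 g) (extend0K fK)
  (extend0K gK) (extend0_congr fg).
case: e1 fE => -> fE; [left|right]; apply/funext => x; apply: val_inj => /=.
  by rewrite -extend0_val fE mul1r.
by rewrite -extend0_val fE mulN1r.
Qed.

Lemma kirch_opp_neq_id : kirch_opp <> id.
Proof. by move/(congr1 (fun h => val (h (exist _ (1 : int) isT)))). Qed.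

Theorem theorem1 : [set f : kirchZ -> kirchZ | homeomorphism f] #= `I_2.
Proof.
apply/eq_cardSP; exists id; first by apply/homeomorphism_kirchE; left.
rewrite (_ : _ `\ _ = [set kirch_opp]); first exact: card_set1.
apply/seteqP; split=> f /=; first by case=> /homeomorphism_kirchE[].
move=> ->; split; first by apply/homeomorphism_kirchE; right.
exact: kirch_opp_neq_id.
Qed.
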